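(* Let $(n,D,\mathbf m)$ be any triple, that is, $n\ge1$, $D\subseteq D(d)$ for some $d\ge1$, and $\mathbf m=(m_1,\ldots,m_r)\in\mathbb N^r$ for some $r\ge1$. If $\mathcal F(D,c,m_r)$ is non-empty for some $c>0$, then for any monomial ordering $\preceq$ on $\mathbb K[X_0,\ldots,X_n]$, the minimal element of $\mathcal F(D,c,m_r)$ with respect to the $\preceq$-lexicographic ordering is a reduction for $(n,D,\mathbf m)$.
   Context: $\mathbb K$ is a field of characteristic $0$, and $\mathbb N=\{0,1,2,\ldots\}$. For $\mathbf a=(a_0,\ldots,a_n)\in\mathbb N^{n+1}$ put $|\mathbf a|=a_0+\cdots+a_n$ and $\mathbf X^{\mathbf a}=X_0^{a_0}\cdots X_n^{a_n}$; $D(d)=\{\mathbf a\in\mathbb N^{n+1}: |\mathbf a|=d\}$ (with $D(-1)=\varnothing$). Matrix: for $\mathbf m=(m_1,\ldots,m_r)$ let $U_i=\{(i,\mathbf b):\mathbf b\in D(m_i-1)\}$ and $U=U_1\cup\cdots\cup U_r$. Let $\mathbf P_i=(P_{i,0},\ldots,P_{i,n})$ be independent indeterminates. $M_D(\mathbf m)$ is the matrix with rows indexed by $U$, columns indexed by $D$, and entry in row $(i,\mathbf b)$, column $\mathbf a$ equal to $\frac{\partial^{|\mathbf b|}\mathbf X^{\mathbf a}}{\partial\mathbf X^{\mathbf b}}(\mathbf P_i)$. For $I\subseteq U$, $J\subseteq D$, $(I,J)$ denotes the sub-matrix with rows $I$ and columns $J$; $\det(\varnothing,\varnothing)=1$.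 For $E\subseteq D(d)$ and $m\in\mathbb N$, the triple $(n,E,(m))$ is non-special if $M_E((m))$ has full rank (as a matrix over the field of rational functions in the indeterminates). $\mathcal F(D,c,m)$ is the set of $E\subseteq D$ with $\#E=c$ such that $(n,E,(m))$ is non-special. A monomial ordering $\preceq$ (a total well-ordering of the monomials compatible with multiplication) induces an ordering of $\mathbb N^{n+1}$ by $\mathbf a\preceq\mathbf b\iff \mathbf X^{\mathbf a}\preceq\mathbf X^{\mathbf b}$. The $\preceq$-lexicographic ordering on $c$-element subsets of $D$: for $E=\{\mathbf a_1\prec\cdots\prec\mathbf a_c\}$ and $F=\{\mathbf b_1\prec\cdots\prec\mathbf b_c\}$, $E\prec F$ iff there is $k\ge1$ with $\mathbf a_k\prec\mathbf b_k$ and $\mathbf a_i=\mathbf b_i$ for all $i<k$. Exceptional partitions: for a square sub-matrix $(U',D')$ of $M_D(\mathbf m)$ put $U'_i=U'\cap U_i$, and let $\mathcal P(U',D')$ be the set of partitions $\mathbf E=(E_1,\ldots,E_r)$ of $D'$ (parts may be empty) with $\#E_i=\#U'_i$ for all $i$. Put $\sigma(\mathbf E)=\pm\prod_{i=1}^r\det(U'_i,E_i)$ (the summand belonging to $\mathbf E$ in the generalized Laplace expansion of $\det(U',D')$ along the row blocks $U'_1,\ldots,U'_r$) and $\mathbf a_i(\mathbf E)=\sum_{\mathbf a\in E_i}\mathbf a$. A partition $\mathbf E\in\mathcal P(U',D')$ is exceptional with respect to $(U',D')$ if (1) $\sigma(\mathbf E)\ne0$; and (2) whenever $D''\subseteq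 D$ has $\#D''=\#D'$ and $\mathbf F\in\mathcal P(U',D'')$ is a partition different from $\mathbf E$ with $\mathbf a_i(\mathbf F)=\mathbf a_i(\mathbf E)$ for all $i$, then $\sigma(\mathbf F)=0$. A set $E\subseteq D$ is a reduction for $(n,D,\mathbf m)$ if for some $U'\subseteq U_r$ with $\#U'=\#E$ the partition $(\varnothing,\ldots,\varnothing,E)$ of $E$ is exceptional with respect to $(U',E)$.
   Formalization: The formal statement also assumes c ≤ #U_r, the number of rows of the last block; for c > #U_r no U' ⊆ U_r has c elements, so no c-element set is a reduction, although F(D,c,m_r) can be non-empty (e.g. m_r = 1, D = D(d), c = 2). *)

(* Defs.v *)
From mathcomp Require Export all_boot all_order all_algebra.
From mathcomp Require Export mpoly.

Set Implicit Arguments.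
Unset Strict Implicit.
Unset Printing Implicit Defensive.

Import GRing.Theory.

Local Open Scope ring_scope.

(* The exponents in N^(n+1) of total degree <= d; this is a finite type, and a
   set D included in D(d) is a finite set D of such exponents. *)
Notation expo n d := ('X_{1..n.+1 < d.+1}).

Definition degset (n d : nat) : {set expo n d} :=
  [set a : expo n d | mdeg a == d].

(* The pairs (i, b) with |b| < m_i.  Its enumeration lists all the pairs with
   first component 0, then all those with first component 1, and so on. *)
Notation rowidx n m := {i & 'X_{1..n.+1 < m i}}.

(* |b| = m_i - 1 is written |b| + 1 = m_i, so that U_i is empty if m_i = 0. *)
Definition Ublk (n r : nat) (m : 'I_r -> nat) (i : 'I_r) : {set rowidx n m} :=
  [set u : rowidx n m | (tag u == i) && ((mdeg (tagged u)).+1 == m (tag u))].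

Definition Urows (n r : nat) (m : 'I_r -> nat) : {set rowidx n m} :=
  \bigcup_(i < r) Ublk n m i.

Section Matrix.

Variables (K : fieldType) (n d r : nat) (m : 'I_r -> nat).

(* K[P_{i,j} : i < r, j <= n] *)
Notation ptpoly := {mpoly K[r * n.+1]}.

Definition Ppt (i : 'I_r) : n.+1.-tuple ptpoly :=
  [tuple 'X_(mxvec_index i j) | j < n.+1].

Definition Mentry (u : rowidx n m) (a : expo n d) : ptpoly :=
  mderivm (tagged u) ('X_[a] : {mpoly K[n.+1]}) \mPo Ppt (tag u).

(* Rows and columns are listed in the order in which their index types are
   enumerated. *)
Definition submx (I : {set rowidx n m}) (J : {set expo n d}) :
    'M[ptpoly]_(#|I|, #|J|) :=
  \matrix_(k, l) Mentry (enum_val k) (enum_val l).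

(* The determinant of the sub-matrix (I, J); it is only meaningful, and only
   used, when I and J have the same cardinality. *)
Definition minor (I : {set rowidx n m}) (J : {set expo n d}) : ptpoly :=
  \det (conform_mx (0 : 'M_#|I|) (submx I J)).

Definition part_of (U' : {set rowidx n m}) (D' : {set expo n d}) :
    {set {ffun 'I_r -> {set expo n d}}} :=
  [set E : {ffun 'I_r -> {set expo n d}} |
    [&& \bigcup_(i < r) E i == D',
        [forall i, forall j, (i != j) ==> [disjoint E i & E j]] &
        [forall i, #|E i| == #|U' :&: Ublk n m i|]]].

(* Number of inversions of the permutation that lists the columns of E_1, then
   those of E_2, and so on (the rows are already sorted by blocks). *)
Definition inversions (E : {ffun 'I_r -> {set expo n d}}) : nat :=
  \sum_(i < r) \sum_(j < r | (i < j)%N)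
    #|[set ab in setX (E i) (E j) | (enum_rank ab.2 < enum_rank ab.1)%N]|.

Definition sigma (U' : {set rowidx n m})
    (E : {ffun 'I_r -> {set expo n d}}) : ptpoly :=
  (-1) ^+ inversions E * \prod_(i < r) minor (U' :&: Ublk n m i) (E i).

Definition expo_sum (E : {set expo n d}) : 'X_{1..n.+1} :=
  (\sum_(a in E) bmnm a)%MM.

Definition exceptional (D : {set expo n d}) (U' : {set rowidx n m})
    (D' : {set expo n d}) (E : {ffun 'I_r -> {set expo n d}}) : Prop :=
  [/\ E \in part_of U' D',
      sigma U' E != 0 &
      forall (D'' : {set expo n d}) (F : {ffun 'I_r -> {set expo n d}}),
        D'' \subset D -> #|D''| = #|D'| ->
        F \in part_of U' D'' -> F != E ->
        (forall i, expo_sum (F i) = expo_sum (E i)) ->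
        sigma U' F = 0].

Definition full_rank (E : {set expo n d}) : bool :=
  let A := map_mx (@tofrac ptpoly) (submx (Urows n m) E) in
  \rank A == minn #|Urows n m| #|E|.

End Matrix.

Definition is_reduction (K : fieldType) (n d r : nat) (m : 'I_r.+1 -> nat)
    (D E : {set expo n d}) : Prop :=
  E \subset D /\
  exists U' : {set rowidx n m},
    [/\ U' \subset Ublk n m ord_max, #|U'| = #|E| &
        exceptional K D U' E [ffun i => if i == ord_max then E else set0]].

Definition nonspecial (K : fieldType) (n d : nat) (E : {set expo n d})
    (m : nat) : bool :=
  full_rank K (fun _ : 'I_1 => m) E.

Definition Fam (K : fieldType) (n d : nat) (D : {set expo n d}) (c m : nat) :
    {set {set expo n d}} :=
  [set E : {set expo n d} | [&& E \subset D, #|E| == c & nonspecial K E m]].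

(* A monomial is identified with its exponent: X^a X^b is a + b. *)
Definition monomial_order (n : nat) (le : rel 'X_{1..n.+1}) : Prop :=
  [/\ reflexive le, antisymmetric le, transitive le & total le] /\
  well_founded (fun a b => (a != b) && le a b) /\
  (forall a b c : 'X_{1..n.+1}, le a b -> le (a + c)%MM (b + c)%MM).

Section Lex.

Variables (n d : nat) (le : rel 'X_{1..n.+1}).

Definition listing (E : {set expo n d}) : seq 'X_{1..n.+1} :=
  sort le [seq bmnm a | a <- enum E].

Definition lex_lt (E F : {set expo n d}) : Prop :=
  exists k : nat,
    let a := nth 0%MM (listing E) in
    let b := nth 0%MM (listing F) in
    [/\ (k < #|E|)%N, (a k != b k) && le (a k) (b k) &
        forall i : nat, (i < k)%N -> a i = b i].

Definition lex_min (FF : {set {set expo n d}}) (E : {set expo n d}) : Prop :=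
  E \in FF /\ forall F, F \in FF -> F = E \/ lex_lt E F.

End Lex.

(* Main.v *)
Require Import Defs.
From mathcomp Require Import perm.

Set Implicit Arguments.
Unset Strict Implicit.
Unset Printing Implicit Defensive.

Import GRing.Theory.
Local Open Scope ring_scope.

(** The theorem is an instance of the greedy principle for matroids, in a form
that needs only determinants.  Let [E] be the lexicographic minimum and let
[U'] be rows of the last block with [det(U', E) != 0].  Suppose that [F] is a
set of [c] exponents of [D] with [det(U', F) != 0], and write [A_E], [A_F] for
the two invertible square matrices.  By Cramer's rule the entry [(i, j)] of
[adj(A_E) A_F] is the determinant of [A_E] with its [i]-th column replaced by
the [j]-th column of [A_F].  As [adj(A_E) A_F] has a nonzero determinant, some
term of its Leibniz expansion is nonzero: there is a permutation [s] such that
replacing the [i]-th exponent [e_i] of [E] by the exponent [f_(s i)] of [F]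
preserves nonsingularity, for every [i] ([det_exchange]).  Each of these
replacements belongs to the family that [E] minimizes, which forces
[e_i <= f_(s i)] ([lex_min_replace]).  Adding up these inequalities, which is
possible since the order is compatible with addition, the sum of [E] is at most
the sum of [F], with equality only if [e_i = f_(s i)] for every [i], that is,
only if [E = F] ([le_sum_mnm], [lex_min_expo_sum]).  Hence no other set with the
same sum has a nonzero minor on the rows [U'].  As the rows [U'] all lie in the
last block, the other parts of a competing partition are empty, so this is
exactly exceptionality.

Nonspeciality refers to a matrix with a single point, whereas a reduction refers
to a block of the matrix with [r] points.  Renaming the variables is a ring
morphism in both directions, and it maps the entries of one matrix to those of
the other, so that nonvanishing determinants correspond
([family_minor_change_block]). *)

(** * The lexicographic order on sets of exponents *)
Lemma bmnm_inj (n d : nat) : injective (@bmnm n d).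
Proof. exact: val_inj. Qed.

Lemma mem_listing (n d : nat) (le : rel 'X_{1..n.+1}) (E : {set expo n d})
    (x : expo n d) :
  (bmnm x \in listing le E) = (x \in E).
Proof. by rewrite mem_sort (mem_map (@bmnm_inj _ _)) mem_enum. Qed.

Lemma size_listing (n d : nat) (le : rel 'X_{1..n.+1}) (E : {set expo n d}) :
  size (listing le E) = #|E|.
Proof. by rewrite size_sort size_map -cardE. Qed.

Lemma listing_uniq (n d : nat) (le : rel 'X_{1..n.+1}) (E : {set expo n d}) :
  uniq (listing le E).
Proof. by rewrite sort_uniq (map_inj_uniq (@bmnm_inj _ _)) enum_uniq. Qed.

Lemma nth_listing (n d : nat) (le : rel 'X_{1..n.+1}) (E : {set expo n d})
    (k : nat) :
  (k < #|E|)%N -> exists2 x, x \in E & nth 0%MM (listing le E) k = bmnm x.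
Proof.
move=> ltk; have: nth 0%MM (listing le E) k \in listing le E.
  by rewrite mem_nth ?size_listing.
rewrite {2}/listing mem_sort => /mapP[x]; rewrite mem_enum => Ex ->.
by exists x.
Qed.

Lemma listing_index (n d : nat) (le : rel 'X_{1..n.+1}) (E : {set expo n d})
    (x : expo n d) :
  x \in E -> exists2 k, (k < #|E|)%N & nth 0%MM (listing le E) k = bmnm x.
Proof.
by rewrite -(mem_listing le) => /(nthP 0%MM)[k]; rewrite size_listing; exists k.
Qed.

Lemma listing_nondecreasing (n d : nat) (le : rel 'X_{1..n.+1})
    (E : {set expo n d}) (i j : nat) :
    monomial_order le -> (i <= j)%N -> (j < #|E|)%N ->
  le (nth 0%MM (listing le E) i) (nth 0%MM (listing le E) j).
Proof.
move=> [[le_refl _ le_trans le_total] _] leij ltj.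
apply: (sorted_leq_nth le_trans le_refl 0%MM (sort_sorted le_total _)) => //.
- by rewrite inE size_listing (leq_ltn_trans leij).
- by rewrite inE size_listing.
Qed.

(** For sets of equal size the lexicographic order depends only on the least
element of the symmetric difference; this turns the comparison of sorted lists
into a statement on membership. *)
Lemma lex_lt_first_diff (n d : nat) (le : rel 'X_{1..n.+1})
    (E F : {set expo n d}) :
    monomial_order le -> #|E| = #|F| -> lex_lt le E F ->
  exists x, [/\ x \in E, x \notin F &
    forall y : expo n d, y != x -> le y x -> (y \in E) = (y \in F)].
Proof.
move=> hle eqEF [k /= [ltk /andP[neqk lek] eqk]].
have [[_ le_asym le_trans _] _] := hle.
have [x Ex ak] := nth_listing le ltk; exists x.
(* From position k on, the listing of F stays strictly above x = a_k, and the
   listing of E at or above it; before position k the two listings agree. *)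
have aboveF j : (k <= j)%N -> (j < #|F|)%N ->
    le (nth 0%MM (listing le F) j) x -> False.
  move=> lekj ltj lejx; case/eqP: neqk; apply: le_asym; rewrite lek /= ak.
  by apply: le_trans lejx; apply: listing_nondecreasing.
have aboveE j : (k <= j)%N -> (j < #|E|)%N -> le x (nth 0%MM (listing le E) j).
  by move=> lekj ltj; rewrite -ak; apply: listing_nondecreasing.
split=> //.
- apply/negP => /(listing_index le)[j ltj bj].
  have [lekj|ltjk] := leqP k j.
    by apply: (aboveF j) => //; rewrite bj; case: hle => -[].
  move: bj; rewrite -eqk // -ak => /eqP.
  have ltkF : (k < #|F|)%N by rewrite -eqEF.
  by rewrite nth_uniq ?listing_uniq ?size_listing ?eqEF // ltn_eqF.
move=> y neqyx leyx; apply/idP/idP => /(listing_index le)[j ltj yj].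
- have [lekj|ltjk] := leqP k j.
    case/eqP: neqyx; apply/bmnm_inj/le_asym; rewrite leyx -yj /=.
    exact: aboveE.
  by rewrite -(mem_listing le) -yj eqk // mem_nth // size_listing -eqEF.
- have [lekj|ltjk] := leqP k j.
    by case: (aboveF j) => //; rewrite yj.
  by rewrite -(mem_listing le) -yj -eqk // mem_nth // size_listing eqEF.
Qed.

Lemma lex_lt_asym (n d : nat) (le : rel 'X_{1..n.+1}) (E F : {set expo n d}) :
  monomial_order le -> #|E| = #|F| -> lex_lt le E F -> ~ lex_lt le F E.
Proof.
move=> hle eqEF ltEF ltFE; have [[_ _ _ le_total] _] := hle.
have [x [Ex Fx agree_x]] := lex_lt_first_diff hle eqEF ltEF.
have [y [Fy Ey agree_y]] := lex_lt_first_diff hle (esym eqEF) ltFE.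
have neqxy : x != y by apply: contraNneq Fx => ->.
case/orP: (le_total x y) => [lexy | leyx].
- by move: (agree_y x neqxy lexy); rewrite Ex (negPf Fx).
- by move: (agree_x y); rewrite eq_sym neqxy leyx Fy (negPf Ey) => /(_ isT isT).
Qed.

Lemma lex_lt_trans (n d : nat) (le : rel 'X_{1..n.+1})
    (E F G : {set expo n d}) :
    monomial_order le -> #|E| = #|F| ->
  lex_lt le E F -> lex_lt le F G -> lex_lt le E G.
Proof.
move=> [[_ le_asym le_trans _] _] eqEF.
move=> [k /= [ltk ltEF eqk]] [l /= [ltl ltFG eql]].
have [ltkl|ltlk|eqkl] := ltngtP k l.
- exists k; split=> // [|i ltik]; first by rewrite -eql.
  by rewrite eqk ?eql // (ltn_trans ltik).
- exists l; split=> [||i ltil]; first exact: ltn_trans ltlk ltk.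
    by rewrite eqk.
  by rewrite eqk ?eql // (ltn_trans ltil).
- subst l; exists k; split=> [||i ltik]; first exact: ltk;
    last by rewrite eqk ?eql.
  case/andP: ltEF => neq1 le1; case/andP: ltFG => neq2 le2.
  rewrite (le_trans _ _ _ le1 le2) andbT.
  apply: contraNneq neq1 => eq13; apply/eqP/le_asym.
  by rewrite le1 eq13 le2.
Qed.

Lemma lex_lt_total (n d : nat) (le : rel 'X_{1..n.+1}) (E F : {set expo n d}) :
    monomial_order le -> #|E| = #|F| ->
  [\/ E = F, lex_lt le E F | lex_lt le F E].
Proof.
move=> [[_ _ _ le_total] _] eqEF.
have [eqs|neqs] := eqVneq (listing le E) (listing le F).
  by constructor 1; apply/setP => x; rewrite -!(mem_listing le) eqs.
pose diff k := (k < #|E|)%N &&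
  (nth 0%MM (listing le E) k != nth 0%MM (listing le F) k).
have exdiff : exists k, diff k.
  have /allPn[k]: ~~ all (fun k => ~~ diff k) (iota 0 #|E|).
    apply: contraNN neqs => /allP eqs; apply/eqP/(@eq_from_nth _ 0%MM).
      by rewrite !size_listing.
    move=> i; rewrite size_listing => lti; apply/eqP.
    by have := eqs i; rewrite mem_iota lti /diff lti negbK; apply.
  by rewrite negbK; exists k.
have [k /andP[ltk neqk] mink] := ex_minnP exdiff.
have eqk i : (i < k)%N ->
    nth 0%MM (listing le E) i = nth 0%MM (listing le F) i.
  move=> ltik; apply/eqP; apply: contraLR ltik => neqi.
  by rewrite -leqNgt; apply: mink; rewrite /diff neqi andbT;
    case: ltnP => // leEi; case/eqP: neqi;
    rewrite !nth_default ?size_listing -?eqEF.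
case/orP: (le_total (nth 0%MM (listing le E) k) (nth 0%MM (listing le F) k)).
- by move=> lek; constructor 2; exists k; split=> //; rewrite neqk.
- move=> lek; constructor 3; exists k; split=> [||i /eqk//].
    by rewrite -eqEF.
  by rewrite eq_sym neqk.
Qed.

(** The lexicographic order is linear only among sets of a fixed size, whence
the assumption on the members of the family. *)
Lemma lex_min_exists (n d c : nat) (le : rel 'X_{1..n.+1})
    (FF : {set {set expo n d}}) :
    monomial_order le -> (forall E, E \in FF -> #|E| = c) ->
    (exists E, E \in FF) ->
  exists E, unique (lex_min le FF) E.
Proof.
move=> hle cardFF [E0 FFE0].
suff [E minE] : exists E, lex_min le FF E.
  exists E; split=> // E' minE'; have [FFE ltE] := minE.
  have [FFE' ltE'] := minE'.
  have [//|lt1] := ltE _ FFE'; have [//|lt2] := ltE' _ FFE.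
  by case: (@lex_lt_asym _ _ le E E') => //; rewrite !cardFF.
have [s0|[E FFE minE]] : enum FF = [::] \/
    exists2 E, E \in enum FF &
      forall F, F \in enum FF -> F = E \/ lex_lt le E F.
- have: {subset enum FF <= FF} by move=> E; rewrite mem_enum.
  elim: (enum FF) => [|G s IHs] sFF; [by left | right].
  have FFG : G \in FF by apply: sFF; rewrite mem_head.
  have [|s0|[E sE minE]] := IHs.
    by move=> F sF; rewrite sFF // inE sF orbT.
  - by exists G; rewrite ?mem_head // s0 => F; rewrite inE => /eqP; left.
  have FFE : E \in FF by rewrite sFF // inE sE orbT.
  have cardGE : #|G| = #|E| by rewrite !cardFF.
  have [eqGE|ltGE|ltEG] := lex_lt_total hle cardGE.
  + exists E; first by rewrite inE sE orbT.
    by move=> F; rewrite inE => /predU1P[->|/minE]; [left|].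
  + exists G; first exact: mem_head.
    move=> F; rewrite inE => /predU1P[->|/minE[->|ltEF]].
    - by left.
    - by right.
    by right; apply: lex_lt_trans ltGE ltEF.
  + exists E; first by rewrite inE sE orbT.
    by move=> F; rewrite inE => /predU1P[->|/minE]; [right|].
- by move: FFE0; rewrite -mem_enum s0.
- exists E; split=> [|F FFF]; last by apply: minE; rewrite mem_enum.
  by rewrite -mem_enum.
Qed.

(** * Sums of exponents *)

(** Strictness survives summation because addition of exponents is
cancellative: a single strict inequality would make the sums different. *)
Lemma le_sum_mnm (k : nat) (I : finType) (le : rel 'X_{1..k.+1})
    (x y : I -> 'X_{1..k.+1}) :
    monomial_order le -> (forall i, le (x i) (y i)) ->
    (\sum_i x i)%MM = (\sum_i y i)%MM ->
  forall i, x i = y i.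
Proof.
move=> [[le_refl le_asym le_trans _] [_ le_add]] lexy eqxy i.
have le_addl a b c : le b c -> le (a + b)%MM (a + c)%MM.
  by rewrite ![(a + _)%MM]addmC; apply: le_add.
have lerest : le (\sum_(j | j != i) x j)%MM (\sum_(j | j != i) y j)%MM.
  apply: (big_ind2 (fun a b => le a b)) => // a b a' b' leab leab'.
  exact: le_trans (le_add _ _ _ leab) (le_addl _ _ _ leab').
move: eqxy; rewrite (bigD1 i) // [RHS](bigD1 i) //= => eqxy.
have: (x i + \sum_(j | j != i) x j = y i + \sum_(j | j != i) x j)%MM.
  apply: le_asym; rewrite (le_add _ _ _ (lexy i)) /= eqxy.
  exact: le_addl.
exact: addIm.
Qed.

(** * Exchanging columns of nonsingular matrices *)

(** Otherwise every term of the Leibniz expansion would vanish. *)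
Lemma det_neq0_perm (R : comPzRingType) (p : nat) (C : 'M[R]_p) :
  \det C != 0 -> exists s : 'S_p, forall i, C i (s i) != 0.
Proof.
move=> detC; have: [exists s : 'S_p, [forall i, C i (s i) != 0]].
  apply: contraNT detC => /existsPn allC; apply/eqP.
  rewrite /determinant big1 // => s _.
  have /forallPn[i /negPn/eqP Ci] := allC s.
  by rewrite (bigD1 i) //= Ci mul0r mulr0.
by case/existsP=> s /forallP; exists s.
Qed.

(** Cramer's rule: the cofactors along a column do not depend on that column. *)
Lemma det_col_replace (R : comPzRingType) (p : nat) (A B : 'M[R]_p)
    (i j : 'I_p) :
  \det (\matrix_(k, l) if l == i then B k j else A k l) = (\adj A *m B) i j.
Proof.
rewrite (expand_det_col _ i) mxE; apply: eq_bigr => k _.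
rewrite !mxE eqxx mulrC; congr (_ * _).
rewrite /cofactor; congr (_ * \det _); apply/matrixP => k' l'.
by rewrite !mxE eq_sym (negPf (neq_lift _ _)).
Qed.

(** The bijective form of basis exchange: one permutation serves all columns at
once.  It comes from a nonzero Leibniz term of [\adj A *m B], whose entries are
the determinants in question. *)
Lemma det_exchange (R : idomainType) (p : nat) (A B : 'M[R]_p) :
    \det A != 0 -> \det B != 0 ->
  exists s : 'S_p, forall i,
    \det (\matrix_(k, l) if l == i then B k (s i) else A k l) != 0.
Proof.
move=> detA detB.
have [s nzs] : exists s : 'S_p, forall i, (\adj A *m B) i (s i) != 0.
  apply: det_neq0_perm; rewrite det_mulmx mulf_neq0 //.
  apply: contraNneq (expf_neq0 p detA) => adj0.
  by rewrite -det_scalar -mul_mx_adj det_mulmx adj0 mulr0.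
by exists s => i; rewrite det_col_replace.
Qed.

(** * Minors along families of rows and columns *)

(** Indexing rows and columns by families instead of sets frees the arguments
from the enumeration order, hence from signs, and keeps all the matrices at the
same size [p]. *)
Definition family_minor (K : fieldType) (n d r p : nat) (m : 'I_r -> nat)
    (u : 'I_p -> rowidx n m) (e : 'I_p -> expo n d) :=
  \det (\matrix_(k, l) Mentry K (u k) (e l)).

Lemma family_minor_rows_inj (K : fieldType) (n d r p : nat) (m : 'I_r -> nat)
    (u : 'I_p -> rowidx n m) (e : 'I_p -> expo n d) :
  family_minor K u e != 0 -> injective u.
Proof.
move=> nz i j equ; apply/eqP; apply: contraNT nz => neqij; apply/eqP.
by apply: (determinant_alternate neqij) => l; rewrite !mxE equ.
Qed.

Lemma family_minor_cols_inj (K : fieldType) (n d r p : nat) (m : 'I_r -> nat)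
    (u : 'I_p -> rowidx n m) (e : 'I_p -> expo n d) :
  family_minor K u e != 0 -> injective e.
Proof.
rewrite /family_minor -det_tr => nz i j eqe; apply/eqP.
apply: contraNT nz => neqij; apply/eqP.
by apply: (determinant_alternate neqij) => l; rewrite !mxE eqe.
Qed.

Lemma family_minor_submx (K : fieldType) (n d r p : nat) (m : 'I_r -> nat)
    (I : {set rowidx n m}) (J : {set expo n d})
    (u : 'I_p -> rowidx n m) (e : 'I_p -> expo n d) :
    (forall k, u k \in I) -> (forall l, e l \in J) ->
  exists (s : 'I_p -> 'I_#|I|) (t : 'I_p -> 'I_#|J|),
    family_minor K u e = \det (mxsub s t (submx K I J)).
Proof.
move=> uI eJ.
exists (fun k => enum_rank_in (uI k) (u k)).
exists (fun l => enum_rank_in (eJ l) (e l)).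
by congr (\det _); apply/matrixP=> k l; rewrite !mxE !enum_rankK_in.
Qed.

Lemma det_mxsub_conform (R : comPzRingType) (p q1 q2 : nat) (s : 'I_p -> 'I_q1)
    (t : 'I_p -> 'I_q2) (A : 'M[R]_(q1, q2)) :
    q1 = p -> q2 = p -> \det (mxsub s t A) != 0 ->
  \det (conform_mx (0 : 'M_q1) A) != 0.
Proof.
move=> e1 e2; subst q1 q2; rewrite conform_mx_id.
have -> : mxsub s t A = rowsub s 1%:M *m A *m colsub t 1%:M.
  rewrite -mulmxA mulmx_colsub mulmx1 -rowsubE.
  by apply/matrixP => i j; rewrite !mxE.
by rewrite !det_mulmx; apply: contraNneq => ->; rewrite mulr0 mul0r.
Qed.

Definition enum_of (T : finType) (A : {set T}) (p : nat) (cA : #|A| = p)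
    (k : 'I_p) : T :=
  enum_val (cast_ord (esym cA) k).

Lemma enum_ofP (T : finType) (A : {set T}) (p : nat) (cA : #|A| = p) k :
  enum_of cA k \in A.
Proof. exact: enum_valP. Qed.

(** All the minors on the rows [I] use the same family of rows [enum_of cI],
which lets columns of several of them be compared and exchanged. *)
Lemma minorE (K : fieldType) (n d r p : nat) (m : 'I_r -> nat)
    (I : {set rowidx n m}) (J : {set expo n d})
    (cI : #|I| = p) (cJ : #|J| = p) :
  minor K I J = family_minor K (enum_of cI) (enum_of cJ).
Proof.
have -> : family_minor K (enum_of cI) (enum_of cJ) =
    \det (mxsub (cast_ord (esym cI)) (cast_ord (esym cJ)) (submx K I J)).
  by congr (\det _); apply/matrixP=> k l; rewrite !mxE.
rewrite /minor; move: (submx K I J).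
move: (#|I|) (#|J|) cI cJ => q1 q2 e1 e2 A; subst q1 q2.
rewrite conform_mx_id; congr (\det _).
by apply/matrixP=> k l; rewrite !mxE !cast_ord_id.
Qed.

(** The family matrix is the product of the set-indexed one with selection
matrices on both sides, so it is singular whenever the latter is. *)
Lemma minor_neq0 (K : fieldType) (n d r p : nat) (m : 'I_r -> nat)
    (I : {set rowidx n m}) (J : {set expo n d})
    (u : 'I_p -> rowidx n m) (e : 'I_p -> expo n d) :
    #|I| = p -> #|J| = p -> (forall k, u k \in I) -> (forall l, e l \in J) ->
  family_minor K u e != 0 -> minor K I J != 0.
Proof.
move=> cI cJ uI eJ; have [s [t ->]] := family_minor_submx K uI eJ.
exact: det_mxsub_conform.
Qed.

(** * Nonspecial sets and nonvanishing minors *)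

(** With at least as many rows as columns, full rank means independent columns,
that is, some maximal minor does not vanish. *)
Lemma full_rankP (K : fieldType) (n d r p : nat) (m : 'I_r -> nat)
    (J : {set expo n d}) :
    #|J| = p -> (p <= #|Urows n m|)%N ->
  full_rank K m J <-> exists (u : 'I_p -> rowidx n m) e,
    [/\ forall k : 'I_p, u k \in Urows n m, forall l : 'I_p, e l \in J &
        family_minor K u e != 0].
Proof.
move=> cJ; rewrite /full_rank /= -{1}cJ => /minn_idPr ->.
set B := map_mx _ _; split=> [/eqP rkB|[u [e [uI eJ]]]].
- have fullB : row_full B by rewrite /row_full rkB.
  pose f := fullrankfun fullB.
  exists (enum_val \o f \o cast_ord (esym cJ)), (enum_of cJ).
  split=> [k|l|]; try exact: enum_valP.
  have := fullrowsub_unit fullB; rewrite -/f unitmxE unitfE.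
  rewrite /B -map_mxsub det_map_mx tofrac_eq0.
  suff -> : family_minor K (enum_val \o f \o cast_ord (esym cJ)) (enum_of cJ)
      = \det (rowsub f (submx K (Urows n m) J)) by [].
  have -> : family_minor K (enum_val \o f \o cast_ord (esym cJ)) (enum_of cJ)
      = \det (mxsub (cast_ord (esym cJ)) (cast_ord (esym cJ))
                (rowsub f (submx K (Urows n m) J))).
    by congr (\det _); apply/matrixP=> k l; rewrite !mxE.
  move: (rowsub _ _); move: (#|J|) cJ => q e1 A; subst q.
  by congr (\det _); apply/matrixP=> k l; rewrite !mxE !cast_ord_id.
- have [s [t ->]] := family_minor_submx K uI eJ => nz.
  have : \det (map_mx (@tofrac _) (mxsub s t (submx K (Urows n m) J))) != 0.
    by rewrite det_map_mx tofrac_eq0.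
  rewrite map_mxsub -/B -unitfE -unitmxE -row_free_unit => /eqP rk.
  rewrite eqn_leq rank_leq_col /=.
  apply: (@leq_trans p); first by rewrite cJ.
  rewrite -{1}rk.
  have -> : mxsub s t B = rowsub s 1%:M *m (B *m colsub t 1%:M).
    by rewrite mulmx_colsub mulmx1 -rowsubE; apply/matrixP => i j; rewrite !mxE.
  exact: leq_trans (mxrankM_maxr _ _) (mxrankM_maxl _ _).
Qed.

(** The substitution [P_(i,j) := P_(g i, j)], which moves the points along
[g]. *)
Definition relabel (K : fieldType) (n r1 r2 : nat) (g : 'I_r1 -> 'I_r2) :
    (r1 * n.+1).-tuple {mpoly K[r2 * n.+1]} :=
  [tuple mxvec (\matrix_(i, j) 'X_(mxvec_index (g i) j)) 0 k
     | k < (r1 * n.+1)%N].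

Lemma relabel_Ppt (K : fieldType) (n r1 r2 : nat) (g : 'I_r1 -> 'I_r2)
    (i : 'I_r1) (q : {mpoly K[n.+1]}) :
  (q \mPo Ppt K n i) \mPo relabel K n g = q \mPo Ppt K n (g i).
Proof.
rewrite !(comp_mpolyE q) linear_sum; apply: eq_bigr => a _.
rewrite linearZ rmorph_prod; congr (_ *: _); apply: eq_bigr => j _.
rewrite rmorphXn; congr (_ ^+ _); rewrite !tnth_mktuple /= comp_mpolyXU.
by rewrite -tnth_nth tnth_mktuple mxvecE mxE.
Qed.

(** Only the order [m1 i1] of the block matters.  The given nonzero minor is the
image of the one sought under the substitution that sends every point to the
[i1]-th one, and a ring morphism maps zero to zero. *)
Lemma family_minor_change_block (K : fieldType) (n d r1 r2 p : nat)
    (m1 : 'I_r1 -> nat) (m2 : 'I_r2 -> nat) (i1 : 'I_r1) (i2 : 'I_r2)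
    (u : 'I_p -> rowidx n m1) (e : 'I_p -> expo n d) :
    m1 i1 = m2 i2 -> (forall k, u k \in Ublk n m1 i1) ->
    family_minor K u e != 0 ->
  exists2 v : 'I_p -> rowidx n m2,
    forall k, v k \in Ublk n m2 i2 & family_minor K v e != 0.
Proof.
move=> eqm uU nz.
have vex k : exists2 w : rowidx n m2, w \in Ublk n m2 i2 &
    bmnm (tagged w) = bmnm (tagged (u k)).
  move: (uU k); case: (u k) => i b; rewrite inE /= => /andP[/eqP eqi mb].
  subst i; have ltb : (mdeg b < m2 i2)%N by rewrite -eqm; case: (b).
  exists (Tagged (fun i => 'X_{1..n.+1 < m2 i}) (BMultinom ltb)) => //.
  by rewrite inE /= eqxx -eqm.
have [v vU vu] := fin_all_exists2 vex.
exists v => //; apply: contraNneq nz => v0.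
suff <- : family_minor K v e \mPo relabel K n (fun=> i1) = family_minor K u e.
  by rewrite v0 comp_mpoly0.
rewrite -det_map_mx; congr (\det _); apply/matrixP => k l.
rewrite !mxE /= /Mentry relabel_Ppt vu.
by have := uU k; rewrite inE => /andP[/eqP <- _].
Qed.

Lemma card_Ublk (n r1 r2 : nat) (m1 : 'I_r1 -> nat) (m2 : 'I_r2 -> nat)
    (i1 : 'I_r1) (i2 : 'I_r2) :
  m1 i1 = m2 i2 -> #|Ublk n m1 i1| = #|Ublk n m2 i2|.
Proof.
have cardE r (m : 'I_r -> nat) (i : 'I_r) :
    #|Ublk n m i| = #|[set b : 'X_{1..n.+1 < m i} | (mdeg b).+1 == m i]|.
  pose T := Tagged (fun i => 'X_{1..n.+1 < m i}).
  have injT : injective (@T i) by move=> b b' /eqP; rewrite eq_Tagged => /eqP.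
  rewrite -(card_imset _ injT); apply: eq_card => -[j b]; rewrite inE /=.
  apply/andP/imsetP => [[/eqP eqji mb]|[b' mb' /eqP eqb]].
    by subst j; exists b; rewrite ?inE.
  have eqji : j = i by move: eqb; rewrite -tag_eqE /tag_eq => /andP[/eqP].
  subst j; move: eqb; rewrite eq_Tagged => /eqP /= ->; split=> //.
  by move: mb'; rewrite inE.
by rewrite !cardE; move: (m1 i1) => q ->.
Qed.

Lemma Urows1 (n : nat) (m : 'I_1 -> nat) : Urows n m = Ublk n m ord0.
Proof. by rewrite /Urows big_ord1. Qed.

(** Nonspeciality can be tested on any block of the right order inside a matrix
with several points. *)
Lemma nonspecialP (K : fieldType) (n d r p : nat) (m : 'I_r -> nat) (i : 'I_r)
    (E : {set expo n d}) :
    #|E| = p -> (p <= #|Ublk n m i|)%N ->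
  nonspecial K E (m i) <-> exists (u : 'I_p -> rowidx n m) e,
    [/\ forall k : 'I_p, u k \in Ublk n m i, forall l : 'I_p, e l \in E &
        family_minor K u e != 0].
Proof.
move=> cE lep; pose m' (_ : 'I_1) := m i.
have lep' : (p <= #|Urows n m'|)%N by rewrite Urows1 (@card_Ublk _ _ _ _ m _ i).
rewrite /nonspecial (full_rankP K cE lep') Urows1.
split=> -[u [e [uU eE nz]]].
- have [v vU nz'] :=
    @family_minor_change_block K n d _ _ p m' m ord0 i u e erefl uU nz.
  by exists v, e.
- have [v vU nz'] :=
    @family_minor_change_block K n d _ _ p m m' i ord0 u e erefl uU nz.
  by exists v, e.
Qed.

Lemma imset_enumeration (T : finType) (A : {set T}) (p : nat) (e : 'I_p -> T) :
    #|A| = p -> injective e -> (forall l, e l \in A) ->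
  e @: 'I_p = A.
Proof.
move=> cA injE eA; apply/eqP; rewrite eqEcard card_imset // card_ord cA leqnn.
by rewrite andbT; apply/subsetP => _ /imsetP[l _ ->].
Qed.

(** * Minimality and sums *)

(** If [e' i] preceded [e i], then the new set would first differ from [E] at
[e' i], which would belong to the new set only, and so it would be smaller than
the minimum. *)
Lemma lex_min_replace (n d p : nat) (le : rel 'X_{1..n.+1})
    (FF : {set {set expo n d}}) (E : {set expo n d})
    (e e' : 'I_p -> expo n d) (i : 'I_p) :
    monomial_order le -> lex_min le FF E -> #|E| = p ->
    injective e -> (forall l, e l \in E) ->
    injective e' -> (forall l, l != i -> e' l = e l) -> e' @: 'I_p \in FF ->
  le (e i) (e' i).
Proof.
move=> hle [_ minE] cE injE eE injE' e'E FFE'.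
have imE := imset_enumeration cE injE eE.
have [[le_refl _ _ le_total] _] := hle.
case: (minE _ FFE') => [eqE|ltE].
  have: e i \in e' @: 'I_p by rewrite eqE.
  case/imsetP=> l _; have [-> <- //|neqli] := eqVneq l i.
  by rewrite e'E // => /injE eqil; rewrite eqil eqxx in neqli.
have cE' : #|E| = #|e' @: 'I_p| by rewrite card_imset // card_ord.
have [x [Ex E'x agree]] := lex_lt_first_diff hle cE' ltE.
(* e i is the only element that can have been lost. *)
have eqx : x = e i.
  move: Ex E'x; rewrite -{1}imE => /imsetP[l _ ->].
  have [-> //|neqli] := eqVneq l i; rewrite -e'E //.
  by rewrite imset_f.
have [<- //|neqe] := eqVneq (e' i) (e i).
case/orP: (le_total (e i) (e' i)) => // le_e'.
have := agree (e' i); rewrite eqx => /(_ neqe le_e').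
rewrite [RHS]imset_f // -imE => /imsetP[l _ eq_e'].
have [eqli|neqli] := eqVneq l i; first by rewrite eq_e' eqli eqxx in neqe.
by move: eq_e'; rewrite -e'E // => /injE' eqil; rewrite eqil eqxx in neqli.
Qed.

Lemma expo_sum_enumeration (n d p : nat) (E : {set expo n d})
    (e : 'I_p -> expo n d) :
    #|E| = p -> injective e -> (forall l, e l \in E) ->
  expo_sum E = (\sum_l bmnm (e l))%MM.
Proof.
move=> cE injE eE; rewrite /expo_sum -(imset_enumeration cE injE eE).
by rewrite big_imset //= => i j _ _ /injE.
Qed.

(** Each replacement supplied by [det_exchange] stays in the family that [E]
minimizes, so [E] is termwise at most [F] along a bijection; equal sums leave
no room for a strict inequality. *)
Lemma lex_min_expo_sum (K : fieldType) (n d r c : nat) (m : 'I_r -> nat)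
    (i : 'I_r) (D E F : {set expo n d}) (U' : {set rowidx n m})
    (le : rel 'X_{1..n.+1}) :
    monomial_order le -> lex_min le (Fam K D c (m i)) E ->
    U' \subset Ublk n m i -> #|U'| = c -> minor K U' E != 0 ->
    F \subset D -> #|F| = c -> minor K U' F != 0 ->
    expo_sum F = expo_sum E ->
  F = E.
Proof.
move=> hle minE sU cU minorE0 sFD cF minorF0 eq_sum.
have [] := minE; rewrite inE => /and3P[sED /eqP cE _] _.
move: minorE0 minorF0; rewrite (minorE K cU cE) (minorE K cU cF).
set u := enum_of cU; set e := enum_of cE; set f := enum_of cF => detE detF.
have injE := family_minor_cols_inj detE.
have injF := family_minor_cols_inj detF.
have [s nz] := det_exchange detE detF.
have lec : (c <= #|Ublk n m i|)%N by rewrite -cU subset_leq_card.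
have lesf j : le (e j) (f (s j)).
  pose e' l := if l == j then f (s j) else e l.
  have nze' : family_minor K u e' != 0.
    apply: contraNneq (nz j) => <-; apply/eqP; congr (\det _).
    by apply/matrixP => k l; rewrite !mxE /e'; case: eqP.
  have injE' := family_minor_cols_inj nze'.
  have e'j : e' j = f (s j) by rewrite /e' eqxx.
  rewrite -e'j; apply: (lex_min_replace hle minE cE injE (enum_ofP cE) injE').
    by move=> l neqlj; rewrite /e' (negPf neqlj).
  have cE' : #|e' @: 'I_c| = c by rewrite card_imset // card_ord.
  rewrite inE cE' eqxx /=; apply/andP; split.
    apply/subsetP => _ /imsetP[l _ ->]; rewrite /e'; case: eqP => _.
      by rewrite (subsetP sFD) ?enum_ofP.
    by rewrite (subsetP sED) ?enum_ofP.
  apply/(nonspecialP K cE' lec); exists u, e'; split=> // [k|l].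
    by rewrite (subsetP sU) ?enum_ofP.
  exact: imset_f.
have eqef : forall j, bmnm (e j) = bmnm (f (s j)).
  apply: (le_sum_mnm hle lesf).
  rewrite -(expo_sum_enumeration cE injE (enum_ofP cE)) -eq_sum.
  rewrite (expo_sum_enumeration cF injF (enum_ofP cF)).
  exact: (reindex_inj (@perm_inj _ s)).
rewrite -(imset_enumeration cE injE (enum_ofP cE)).
apply/esym/(imset_enumeration cF injE) => j.
by rewrite (bmnm_inj (eqef j)) enum_ofP.
Qed.

(** * Reductions *)

Lemma setI_Ublk (n r : nat) (m : 'I_r -> nat) (i j : 'I_r)
    (U' : {set rowidx n m}) :
  U' \subset Ublk n m i -> U' :&: Ublk n m j = if j == i then U' else set0.
Proof.
move=> sU; have [->|neqji] := eqVneq j i; first exact/setIidPl.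
apply/setP => u; rewrite !inE; apply/negbTE/andP => -[/(subsetP sU)].
rewrite inE => /andP[/eqP tagi _] /andP[/eqP tagj _].
by rewrite -tagi -tagj eqxx in neqji.
Qed.

(* r.+1 is the number of points, so that m_r is (m ord_max).
   The bound on c is needed: if c exceeds the number of rows in the last block,
   then no set of c exponents is a reduction, although the matrix may still
   have full (row) rank. *)
Theorem theorem4p8 (K : fieldType) (charK0 : [pchar K] =i pred0)
    (n d r : nat) (hn : (1 <= n)%N) (hd : (1 <= d)%N)
    (D : {set expo n d}) (hD : D \subset degset n d)
    (m : 'I_r.+1 -> nat) (c : nat) (hc : (0 < c)%N)
    (hcU : (c <= #|Ublk n m ord_max|)%N)
    (hF : exists E : {set expo n d}, E \in Fam K D c (m ord_max))
    (le : rel 'X_{1..n.+1}) (hle : monomial_order le) :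
  exists E : {set expo n d},
    unique (lex_min le (Fam K D c (m ord_max))) E /\ is_reduction K m D E.
Proof.
have cFam E : E \in Fam K D c (m ord_max) -> #|E| = c.
  by rewrite inE => /and3P[_ /eqP].
have [E uniqE] := lex_min_exists hle cFam hF.
exists E; split=> //; have [minE _] := uniqE; have [] := minE.
rewrite inE => /and3P[sED /eqP cE /(nonspecialP K cE hcU)[u [e [uU eE nz]]]] _.
split=> //; exists (u @: 'I_c); set U' := u @: _.
have cU : #|U'| = c.
  by rewrite card_imset ?card_ord //; apply: family_minor_rows_inj nz.
have sU : U' \subset Ublk n m ord_max by apply/subsetP => _ /imsetP[k _ ->].
have minorUE : minor K U' E != 0.
  by apply: minor_neq0 nz => // k; apply: imset_f.
split=> //; first by rewrite cU.
set E0 := finfun _.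
have E0E i : E0 i = if i == ord_max then E else set0 by rewrite ffunE.
split.
- rewrite inE; apply/and3P; split.
  + rewrite (bigD1 ord_max) //= E0E eqxx big1 ?setU0 // => i neqi.
    by rewrite E0E (negPf neqi).
  + apply/forallP => i; apply/forallP => j; apply/implyP => neqij.
    rewrite !E0E -setI_eq0; have [eqi|_] := eqVneq i ord_max;
      last by rewrite set0I.
    by rewrite -eqi [j == _]eq_sym (negPf neqij) setI0.
  + apply/forallP => i; rewrite E0E (setI_Ublk _ sU).
    by case: (i == ord_max); rewrite ?cE ?cU ?cards0.
- rewrite mulf_neq0 ?signr_eq0 //; apply/prodf_neq0 => i _.
  rewrite E0E (setI_Ublk _ sU); case: (i == ord_max) => //.
  have c0 (T : finType) : #|@set0 T| = 0%N by rewrite cards0.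
  by rewrite (minorE K (c0 _) (c0 _)) /family_minor det_mx00 oner_neq0.
- move=> D'' F sD'' _; rewrite inE => /and3P[/eqP covF _ /forallP cardF].
  move=> neqFE sumF.
  apply/eqP; apply: contraNT neqFE => nzF.
  have minorF i : minor K (U' :&: Ublk n m i) (F i) != 0.
    apply: contraNneq nzF => minor0.
    by rewrite /sigma (bigD1 i) //= minor0 mul0r mulr0.
  apply/eqP/ffunP => i; rewrite E0E; have := cardF i; have := minorF i.
  rewrite (setI_Ublk _ sU); have [-> | _ _] := eqVneq i ord_max; last first.
    by rewrite cards0 cards_eq0 => /eqP.
  move=> minorF0 /eqP cF; apply: (lex_min_expo_sum hle minE sU) => //.
  + apply: subset_trans sD''; rewrite -covF; exact: bigcup_sup.
  + by rewrite cF.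
  + by rewrite sumF E0E eqxx.
Qed.
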